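(* Let $$\varphi_8^{\pm}(x,y)=x^8-(84\pm56\sqrt2)x^6y^2+(1190\pm840\sqrt2)x^4y^4-(2772\pm1960\sqrt2)x^2y^6+(577\pm408\sqrt2)y^8,$$ and let $P_8^+(T)$ and $P_8^-(T)$ be the zeta polynomials of $\varphi_8^+(x,y)$ (with $q=4+2\sqrt2$) and of $\varphi_8^-(x,y)$ (with $q=4-2\sqrt2$), respectively. Then: (i) Some of the roots $\alpha\in\mathbf{C}$ of $P_8^+(T)$ do not satisfy $|\alpha|=1/\sqrt{4+2\sqrt2}$ (the Riemann hypothesis is false). (ii) All the roots $\alpha\in\mathbf{C}$ of $P_8^-(T)$ satisfy $|\alpha|=1/\sqrt{4-2\sqrt2}$ (the Riemann hypothesis is true).
   Context: Zeta polynomial: for a homogeneous polynomial $W(x,y)=x^n+\sum_{i=d}^nA_ix^{n-i}y^i\in\mathbf{C}[x,y]$ with $A_d\ne0$ (here $d\ge 2$) and real $q>0$, $q\neq1$, the zeta polynomial of $W$ is the unique polynomial $P(T)\in\mathbf{C}[T]$ of degree at most $n-d$ such that, expanding in powers of $T$, the coefficient of $T^{n-d}$ in $$\frac{P(T)}{(1-T)(1-qT)}\,(y(1-T)+xT)^n$$ equals $\dfrac{W(x,y)-x^n}{q-1}$. For $\varphi_8^\pm$ one has $n=8$, $d=2$. Riemann hypothesis: for a matrix $\sigma=\begin{pmatrix} a&b\\ c&e\end{pmatrix}$ put $f^\sigma(x,y)=f(ax+by,cx+ey)$, and let $\sigma_q=\frac{1}{\sqrt q}\begin{pmatrix}1&q-1\\1&-1\end{pmatrix}$;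 a homogeneous polynomial $W(x,y)=x^n+\sum_{i=d}^nA_ix^{n-i}y^i\in\mathbf{C}[x,y]$ (with $A_d\ne0$, $d\ge2$) with $W^{\sigma_q}=\pm W$ is said to satisfy the Riemann hypothesis if all zeros of its zeta polynomial $P(T)$ have absolute value $1/\sqrt q$. The polynomials $\varphi_8^\pm$ satisfy $(\varphi_8^\pm)^{\sigma_q}=-\varphi_8^\pm$ for $q=4\pm2\sqrt2$ (corresponding signs). *)

(* Defs.v *)
From HB Require Import structures.
From mathcomp Require Import all_boot all_order all_algebra.
From mathcomp Require Import reals complex mpoly.

Set Implicit Arguments.
Unset Strict Implicit.
Unset Printing Implicit Defensive.

Import Order.TTheory GRing.Theory Num.Theory.
Local Open Scope ring_scope.
Local Open Scope complex_scope.

(* A formal power series over A is the sequence nat -> A of its coefficients;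
   F is the expansion of the fraction N / D when D * F = N (Cauchy product).
   F is uniquely determined by N and D when the constant term of D is a unit. *)
Definition power_series_expansion (A : comNzRingType) (N D : {poly A})
    (F : nat -> A) : Prop :=
  forall k : nat, \sum_(i < k.+1) D`_i * F (k - i)%N = N`_k.

Section Zeta.
Variable R : realType.
Local Notation C := R[i].

Definition xvar : {mpoly C[2]} := 'X_ord0.
Definition yvar : {mpoly C[2]} := 'X_ord_max.

Definition enumerator_form (n d : nat) (W : {mpoly C[2]}) : Prop :=
  exists2 A : nat -> C, A d != 0 &
    W = xvar ^+ n + \sum_(d <= i < n.+1) A i *: (xvar ^+ (n - i) * yvar ^+ i).

(* Polynomials in T are elements of {poly {mpoly C[2]}}: there 'X is T, and
   P(T) is embedded coefficientwise. *)
Definition zeta_numerator (n : nat) (P : {poly C}) : {poly {mpoly C[2]}} :=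
  map_poly (@mpolyC 2 C) P * (yvar%:P * (1 - 'X) + xvar%:P * 'X) ^+ n.

Definition zeta_denominator (q : R) : {poly {mpoly C[2]}} :=
  (1 - 'X) * (1 - (q%:C)%:MP%:P * 'X).

Definition is_zeta_polynomial (n d : nat) (q : R) (W : {mpoly C[2]})
    (P : {poly C}) : Prop :=
  [/\ (2 <= d <= n)%N, 0 < q /\ q != 1, enumerator_form n d W,
      (size P <= (n - d).+1)%N &
      exists2 F : nat -> {mpoly C[2]},
        power_series_expansion (zeta_numerator n P) (zeta_denominator q) F &
        F (n - d)%N = (q%:C - 1)^-1 *: (W - xvar ^+ n)].

(* phi8 s is phi_8^+ for s = sqrt 2 and phi_8^- for s = - sqrt 2; the
   corresponding value of q is q8 s. *)
Definition phi8 (s : R) : {mpoly C[2]} :=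
  xvar ^+ 8
  - (84 + 56 * s)%:C *: (xvar ^+ 6 * yvar ^+ 2)
  + (1190 + 840 * s)%:C *: (xvar ^+ 4 * yvar ^+ 4)
  - (2772 + 1960 * s)%:C *: (xvar ^+ 2 * yvar ^+ 6)
  + (577 + 408 * s)%:C *: yvar ^+ 8.

Definition q8 (s : R) : R := 4 + 2 * s.

End Zeta.

(* Main.v *)
Require Import Defs.
From mathcomp Require Import all_boot all_order all_algebra.
From mathcomp Require Import reals complex mpoly.
From mathcomp Require Import ring lra zify.

Import Order.TTheory GRing.Theory Num.Theory.
Local Open Scope ring_scope.
Local Open Scope complex_scope.

(* Writing y(1 - T) + xT = y + (x - y)T, the T^(n-d) coefficient of the
   defining fraction is a combination of the forms (x - y)^k y^(n-k), whose
   coefficients are the Taylor coefficients of P(T) / ((1 - T)(1 - qT)); these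
   forms being free, P is determined by W.  For phi8 with s = sqrt 2 or
   - sqrt 2 and r = sqrt 10 the zeta polynomial is, up to a constant,
     (T^2 - 1/q) (T^2 - v T + 1/q) (T^2 - v' T + 1/q),
   v, v' = (s +- r)/4 and 1/q = (2 - s)/4.  A real quadratic
   T^2 - v T + 1/q has both roots on the circle |T|^2 = 1/q when v^2 <= 4/q.
   This holds for both quadratics when s = - sqrt 2, whereas for s = sqrt 2 the
   root v = (s + r)/4 > 1 violates it and gives a real root larger than 1/2. *)

(** * Power series expansions of fractions *)

Lemma expansion_prefix_unique (A : comNzRingType) (N D : {poly A})
    (F F' : nat -> A) (m : nat) :
  D`_0 = 1 ->
  (forall k, (k < m)%N -> \sum_(i < k.+1) D`_i * F (k - i)%N = N`_k) ->
  (forall k, (k < m)%N -> \sum_(i < k.+1) D`_i * F' (k - i)%N = N`_k) ->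
  forall k, (k < m)%N -> F k = F' k.
Proof.
move=> D0 hF hF' k; elim/ltn_ind: k => k IHk km.
have := hF k km; rewrite -(hF' k km) !big_ord_recl D0 !mul1r !subn0.
suff -> : \sum_(i < k) D`_(lift ord0 i) * F (k - lift ord0 i)%N
        = \sum_(i < k) D`_(lift ord0 i) * F' (k - lift ord0 i)%N by move/addIr.
apply: eq_bigr => i _; have ik := ltn_ord i.
by rewrite IHk //= /bump /=; [rewrite subnS; lia | lia].
Qed.

Lemma coef_binomial_power (A : comNzRingType) (u y : A) (n k : nat) :
  ((y%:P + u%:P * 'X) ^+ n)`_k = (y ^+ (n - k) * u ^+ k) *+ 'C(n, k).
Proof.
have -> : (y%:P + u%:P * 'X) ^+ n
        = \poly_(i < n.+1) ((y ^+ (n - i) * u ^+ i) *+ 'C(n, i)).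
  rewrite exprDn poly_def; apply: eq_bigr => i _.
  rewrite exprMn -!polyC_exp mulrA -polyCM mul_polyC.
  by rewrite -scalerMnl.
by rewrite coef_poly ltnS; case: leqP => // nk; rewrite bin_small.
Qed.

Section TruncatedInverse.
Variables (A : comNzRingType) (a : A).

Let D : {poly A} := (1 - 'X) * (1 - a%:P * 'X).

(* Its product with D is (1 - T^m)(1 - a^m T^m). *)
Definition truncated_inverse (m : nat) : {poly A} :=
  (\sum_(i < m) 'X^i) * (\sum_(i < m) (a%:P * 'X) ^+ i).

Lemma mul_truncated_inverse (m : nat) :
  exists E : {poly A}, D * truncated_inverse m = 1 + E * 'X^m.
Proof.
exists (- (1 + (a ^+ m)%:P) + (a ^+ m)%:P * 'X^m).
have geom (z : {poly A}) : (1 - z) * (\sum_(i < m) z ^+ i) = 1 - z ^+ m.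
  by rewrite -[1 - z]opprB mulNr -subrX1 opprB.
rewrite /D /truncated_inverse mulrACA !geom exprMn -polyC_exp.
by ring.
Qed.

Lemma coef0_denominator : D`_0 = 1.
Proof. by rewrite /D coef0M !coefB !coefCM !coefX !coef1 /=; ring. Qed.

(** The coefficient of T^k is read off the truncation of order k + 1. Truncations of higher order
    satisfy the same first k + 1 equations, hence agree with it there by prefix uniqueness. *)
Lemma expansion_exists (N : {poly A}) : exists F, power_series_expansion N D F.
Proof.
pose G k := N * truncated_inverse k.
have DG k m : (k < m)%N -> \sum_(i < k.+1) D`_i * (G m)`_(k - i) = N`_k.
  move=> km; rewrite -coefM /G mulrCA.
  have [E ->] := mul_truncated_inverse m.
  by rewrite mulrDr mulr1 mulrA coefD coefMXn km addr0.
exists (fun k => (G k.+1)`_k) => k; rewrite -[RHS](DG k k.+1) //.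
apply: eq_bigr => i _; congr (_ * _).
apply: (@expansion_prefix_unique _ N D (nth 0 (G (k - i).+1)) (nth 0 (G k.+1))
          (k - i).+1) => // [|j jk|j jk]; first exact: coef0_denominator.
- by rewrite DG.
- by rewrite DG //; have := ltn_ord i; lia.
Qed.

Lemma expansion_coef (N G E : {poly A}) (F : nat -> A) (m k : nat) :
  power_series_expansion N D F -> D * G = N + E * 'X^m -> (k < m)%N ->
  F k = G`_k.
Proof.
move=> hF hG; apply: (@expansion_prefix_unique _ N D _ _ m).
- exact: coef0_denominator.
- by move=> j _; apply: hF.
- by move=> j jm; rewrite -coefM hG coefD coefMXn jm addr0.
Qed.

End TruncatedInverse.

(** The variables x and y enter only through the n-th power, so the quotient of P by the denominator
    can be computed over the scalars modulo T^(m+1) and its coefficients then transported along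
    [f]. *)
Lemma binomial_expansion_coef (K A : comNzRingType) (f : {rmorphism K -> A})
    (a : K) (u y : A) (n m : nat) (P G E : {poly K}) (F : nat -> A) :
  power_series_expansion (map_poly f P * (y%:P + u%:P * 'X) ^+ n)
    ((1 - 'X) * (1 - (f a)%:P * 'X)) F ->
  (1 - 'X) * (1 - a%:P * 'X) * G = P + E * 'X^(m.+1) ->
  F m = \sum_(k < m.+1) f G`_k *
          ((y ^+ (n - (m - k)) * u ^+ (m - k)) *+ 'C(n, m - k)).
Proof.
set Y := (_ + _) ^+ n => hF hG.
rewrite (@expansion_coef _ _ _ (map_poly f G * Y)
           (map_poly f E * Y) _ m.+1 m hF) //; last first.
  have fD : (1 - 'X) * (1 - (f a)%:P * 'X)
          = map_poly f ((1 - 'X) * (1 - a%:P * 'X)).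
    by rewrite !(rmorphM, rmorphB) /= rmorph1 map_polyC map_polyX.
  have e : (1 - 'X) * (1 - (f a)%:P * 'X) * map_poly f G
         = map_poly f P + map_poly f E * 'X^(m.+1).
    by rewrite fD -rmorphM hG rmorphD rmorphM /= map_polyXn.
  by rewrite mulrA e mulrDl mulrAC.
rewrite coefM; apply: eq_bigr => k _.
by rewrite coef_map /= coef_binomial_power.
Qed.

(** * Uniqueness of the zeta polynomial *)

Section Zeta.
Variable R : realType.
Local Notation C := R[i].
Local Notation x := (xvar R).
Local Notation y := (yvar R).

Lemma zeta_numeratorE (n : nat) (P : {poly C}) :
  zeta_numerator n P
  = map_poly (@mpolyC 2 C) P * (y%:P + (x - y)%:P * 'X) ^+ n.
Proof.
rewrite /zeta_numerator polyCB mulrBl mulrBr mulr1.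
by rewrite -addrA [- _ + _]addrC.
Qed.

Lemma zeta_expansion_coef (n m : nat) (q : R) (P G E : {poly C})
    (F : nat -> {mpoly C[2]}) :
  power_series_expansion (zeta_numerator n P) (zeta_denominator q) F ->
  (1 - 'X) * (1 - (q%:C)%:P * 'X) * G = P + E * 'X^(m.+1) ->
  F m = \sum_(k < m.+1) (G`_k)%:MP *
          ((y ^+ (n - (m - k)) * (x - y) ^+ (m - k)) *+ 'C(n, m - k)).
Proof.
rewrite zeta_numeratorE /zeta_denominator.
exact: (@binomial_expansion_coef C {mpoly C[2]} (@mpolyC 2 C) q%:C (x - y) y).
Qed.

(** The substitution x = 1 + 'X, y = 1 turns (x - y)^j y^(n - j) into 'X^j, and the binomial factor
    is nonzero in C since j <= m <= n. *)
Lemma binomial_forms_free (n m : nat) (c : nat -> C) :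
  (m <= n)%N ->
  \sum_(k < m.+1) (c k)%:MP *
     ((y ^+ (n - (m - k)) * (x - y) ^+ (m - k)) *+ 'C(n, m - k)) = 0 ->
  forall k, (k <= m)%N -> c k = 0.
Proof.
move=> mn /(congr1 (mmap (polyC : C -> {poly C})
                      (fun i => if i == ord0 then 1 + 'X else 1))).
rewrite rmorph0 rmorph_sum /= => h k km.
have {h}: \sum_(i < m.+1) (c i *+ 'C(n, m - i)) *: 'X^(m - i) = 0 :> {poly C}.
  rewrite -[RHS]h; apply: eq_bigr => i _.
  rewrite rmorphM rmorphMn rmorphM !rmorphXn rmorphB /= /xvar /yvar !mmapX !mmap1U mmapC /=.
  by rewrite expr1n mul1r addrAC subrr add0r mulrnAr -mul_polyC polyCMn mulrnAl.
move/(congr1 (fun p : {poly C} => p`_(m - k))).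
rewrite coef0 coef_sum (bigD1 (inord k)) //= big1 ?addr0.
  rewrite coefZ coefXn inordK ?ltnS // eqxx mulr1 => /eqP.
  rewrite mulrn_eq0 => /orP[|/eqP //].
  by rewrite eqn0Ngt bin_gt0 (leq_trans (leq_subr _ _)).
move=> i ik; rewrite coefZ coefXn; case: eqP; rewrite ?mulr0 // => e.
by case/negP: ik; apply/eqP/val_inj; rewrite /= inordK //; have := ltn_ord i; lia.
Qed.

(** By freeness, W fixes the Taylor coefficients of P / ((1 - T)(1 - qT)) up to order n - d.
    Multiplying back by the denominator recovers P modulo T^(n-d+1), which is all of P by the degree
    bound. *)
Lemma zeta_polynomial_unique (n d : nat) (q : R) (W : {mpoly C[2]})
    (P P' : {poly C}) :
  is_zeta_polynomial n d q W P -> is_zeta_polynomial n d q W P' -> P = P'.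
Proof.
move=> [_ _ _ sP [F hF FE]] [_ _ _ sP' [F' hF' FE']].
have mn : (n - d <= n)%N by exact: leq_subr.
move: (n - d)%N => m in sP sP' FE FE' mn *.
pose D := ((1 - 'X) * (1 - (q%:C)%:P * 'X) : {poly C}).
pose H := truncated_inverse C q%:C m.+1.
have [E hE] := mul_truncated_inverse C q%:C m.+1.
have DH (S : {poly C}) : D * (S * H) = S + S * E * 'X^(m.+1).
  by rewrite mulrCA hE mulrDr mulr1 mulrA.
have GG k : (k <= m)%N -> (P * H)`_k = (P' * H)`_k.
  move=> km; apply/eqP; rewrite -subr_eq0; apply/eqP.
  apply: (@binomial_forms_free n m (fun k => (P * H)`_k - (P' * H)`_k)) => //.
  under eq_bigr => i _ do rewrite mpolyCB mulrBl.
  rewrite sumrB -(zeta_expansion_coef _ _ _ _ _ _ _ hF (DH P)).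
  by rewrite -(zeta_expansion_coef _ _ _ _ _ _ _ hF' (DH P')) FE FE' subrr.
have coefDH (S : {poly C}) k : (k <= m)%N -> S`_k = (D * (S * H))`_k.
  by move=> km; rewrite DH coefD coefMXn ltnS km addr0.
apply/polyP => k; have [km|mk] := leqP k m; last first.
  by rewrite !nth_default // (leq_trans _ mk).
rewrite coefDH // [RHS]coefDH // !coefM.
by apply: eq_bigr => i _; rewrite GG // (leq_trans (leq_subr _ _)).
Qed.

End Zeta.

(* An expression in an arbitrary ring, so that one ring identity serves
   both for the polynomial (X = 'X) and for its values (X = alpha). *)
Definition zeta8 (A : comNzRingType) (t X : A) : A :=
  ((4 + 2 * t) * X ^+ 2 - 1)
  * (1 - (2 + 2 * t) * X - (4 + 4 * t) * X ^+ 2 - (16 + 12 * t) * X ^+ 3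
     + (24 + 16 * t) * X ^+ 4).

(** * The explicit zeta polynomial of [phi8] *)

Section Zeta8Poly.
Variables (K : comNzRingType) (t : K).
Hypothesis t2 : t ^+ 2 = 2.

Let tP : (t%:P : {poly K}) ^+ 2 = 2.
Proof. by rewrite -polyC_exp t2 polyC_natr. Qed.

Lemma size_zeta8 : (size (zeta8 {poly K} t%:P 'X) <= 7)%N.
Proof.
have -> : zeta8 {poly K} t%:P 'X = Poly [:: -1; 2 + 2 * t; 8 + 6 * t; 0;
    - 56 - 40 * t; - 112 - 80 * t; 160 + 112 * t].
  rewrite /= !cons_poly_def polyC0 /zeta8.
  by ring: tP.
exact: size_Poly.
Qed.

Lemma horner_zeta8 (z : K) : (zeta8 {poly K} t%:P 'X).[z] = zeta8 K t z.
Proof. by rewrite /zeta8 -!polyC_natr !hornerE. Qed.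

(* The coefficients of T^0, ..., T^6 in zeta8 / ((1 - T)(1 - qT)), that is the
   Taylor coefficients of (phi8(1 + u, 1) - (1 + u)^8) / (q - 1), the one of
   u^(6 - k) being divided by 'C(8, 6 - k). *)
Definition zeta8_quotient : {poly K} :=
  Poly [:: -1; -3; 2 * t - 3; 5 + 10 * t; 13 + 18 * t;
        - (35 + 14 * t); - (195 + 126 * t)].

Lemma zeta8_quotientE : exists E : {poly K},
  (1 - 'X) * (1 - (4 + 2 * t)%:P * 'X) * zeta8_quotient
  = zeta8 {poly K} t%:P 'X + E * 'X^7.
Proof.
(* The denominator is 1 - (5 + 2t)T + (4 + 2t)T^2; these are the terms in T^7 and T^8 of its product
   with the truncated quotient. *)
exists ((- ((5 + 2 * t) * (- 195 - 126 * t)) + (4 + 2 * t) * (- 35 - 14 * t))%:P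
      + ((4 + 2 * t) * (- 195 - 126 * t))%:P * 'X).
rewrite /zeta8_quotient /= !cons_poly_def polyC0 /zeta8.
by ring: tP.
Qed.

End Zeta8Poly.

(** Since t^2 = 2, the factor 3 - 2t is the inverse of q - 1 = 3 + 2t; writing it so avoids division
    and leaves an identity for [ring]. *)
Lemma zeta8_quotient_binomial (K A : comNzRingType) (f : {rmorphism K -> A})
    (t : K) (x y : A) : t ^+ 2 = 2 ->
  \sum_(k < 7) f (zeta8_quotient K t)`_k *
     ((y ^+ (8 - (6 - k)) * (x - y) ^+ (6 - k)) *+ 'C(8, 6 - k))
  = (3 - 2 * f t) * (- ((84 + 56 * f t) * (x ^+ 6 * y ^+ 2))
    + (1190 + 840 * f t) * (x ^+ 4 * y ^+ 4)
    - (2772 + 1960 * f t) * (x ^+ 2 * y ^+ 6) + (577 + 408 * f t) * y ^+ 8).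
Proof.
move=> /(congr1 f); rewrite rmorphXn rmorph_nat /= => t2.
rewrite !big_ord_recl big_ord0 /zeta8_quotient !coef_Poly /= /bump /=.
have -> : 'C(8, 6) = 28 by []. have -> : 'C(8, 5) = 56 by [].
have -> : 'C(8, 4) = 70 by []. have -> : 'C(8, 3) = 56 by [].
have -> : 'C(8, 2) = 28 by []. have -> : 'C(8, 1) = 8 by [].
rewrite bin0.
by ring: t2.
Qed.

Definition even_weights8 (K : nzRingType) (a b c e : K) (i : nat) : K :=
  match i with 2 => a | 4 => b | 6 => c | 8 => e | _ => 0 end.

Lemma sum_even_weights8 (K : nzRingType) (V : lmodType K) (a b c e : K)
    (v : nat -> V) :
  \sum_(2 <= i < 9) even_weights8 K a b c e i *: v i
  = a *: v 2 + b *: v 4 + c *: v 6 + e *: v 8.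
Proof.
rewrite /index_iota /= !big_cons big_nil /= !scale0r.
by rewrite !(add0r, addr0) !addrA.
Qed.

Section Phi8.
Variable R : realType.
Local Notation C := R[i].
Local Notation x := (xvar R).
Local Notation y := (yvar R).

Lemma enumerator_form_phi8 (s : R) : 84 + 56 * s != 0 ->
  enumerator_form 8 2 (phi8 s).
Proof.
move=> s0.
exists (even_weights8 C (- (84 + 56 * s)%:C) (1190 + 840 * s)%:C
          (- (2772 + 1960 * s)%:C) (577 + 408 * s)%:C).
  by rewrite /= oppr_eq0 fmorph_eq0.
rewrite (@sum_even_weights8 C {mpoly C[2]} _ _ _ _ (fun i => x ^+ (8 - i) * y ^+ i)).
by rewrite /phi8 !scaleNr subnn expr0 mul1r !addrA.
Qed.

Lemma zeta8_polynomial (s : R) : s ^+ 2 = 2 -> 0 < q8 s -> q8 s != 1 ->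
  is_zeta_polynomial 8 2 (q8 s) (phi8 s) (zeta8 {poly C} s%:C%:P 'X).
Proof.
move=> s2 q0 q1; set t := s%:C.
have t2 : t ^+ 2 = 2 by rewrite /t -rmorphXn /= s2 rmorph_nat.
have qE : (q8 s)%:C = 4 + 2 * t.
  by rewrite /q8 rmorphD rmorphM /= !rmorph_nat.
(* A vanishing A_2 would force s = -3/2, against s^2 = 2. *)
split=> //; first by apply: enumerator_form_phi8; nra.
  exact: size_zeta8.
have [F hF] := @expansion_exists {mpoly C[2]} (q8 s)%:C%:MP
   (zeta_numerator 8 (zeta8 {poly C} t%:P 'X)).
exists F => //.
have [E hG] := zeta8_quotientE C t t2; rewrite -qE in hG.
rewrite (zeta_expansion_coef _ _ _ _ _ _ _ _ hF hG).
have qV : ((q8 s)%:C - 1)^-1 = 3 - 2 * t.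
  by apply: mulr1_eq; rewrite qE; ring: t2.
rewrite qV -(mul_mpolyC (3 - 2 * t)).
have tM : t%:MP_[2] ^+ 2 = 2 :> {mpoly C[2]}.
  by rewrite -rmorphXn /= t2 rmorph_nat.
have linE (a b : nat) : ((a%:R + b%:R * s)%:C)%:MP_[2] = a%:R + b%:R * t%:MP_[2].
  by rewrite -/t !(rmorphD, rmorphM) /= !rmorph_nat.
rewrite /phi8 -!mul_mpolyC !linE.
rewrite (@zeta8_quotient_binomial C {mpoly C[2]} (@mpolyC 2 C) t x y t2).
have -> : (3 - 2 * t)%:MP_[2] = 3 - 2 * t%:MP_[2].
  by rewrite rmorphB rmorphM /= !rmorph_nat.
have cancel_lead (V : zmodType) (p a b c e : V) :
    - a + b - c + e = p - a + b - c + e - p.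
  by rewrite [RHS]addrAC; congr (_ + e); rewrite [RHS]addrAC; congr (_ - c);
     rewrite [RHS]addrAC; congr (_ + b); rewrite [RHS]addrAC subrr add0r.
by congr (_ * _); exact: cancel_lead.
Qed.

End Phi8.

(** * Absolute values of the zeros *)

Lemma norm_sqrt_root (R : rcfType) (w : R) (z : R[i]) : 0 <= w ->
  z ^+ 2 = w%:C -> `|z| = (Num.sqrt w)%:C.
Proof.
move=> w0; rewrite -{1}[w]sqr_sqrtr // rmorphXn => /eqP.
rewrite eqf_sqr => /orP[] /eqP ->; rewrite ?normrN ger0_norm //.
all: by rewrite lecR sqrtr_ge0.
Qed.

(** For z = a + bi with b nonzero, the imaginary part gives v = 2a and the real part then a^2 + b^2
    = w. A real root forces v^2 = 4w, so z = v/2 and z^2 = w. *)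
Lemma norm_quadratic_root (R : rcfType) (v w : R) (z : R[i]) :
  v ^+ 2 <= 4 * w -> z ^+ 2 - v%:C * z + w%:C = 0 -> `|z| = (Num.sqrt w)%:C.
Proof.
case: z => a b vw /eqP; rewrite eq_complex /= => /andP[/eqP re /eqP im].
rewrite normc_def /=; congr ((Num.sqrt _)%:C).
have [b0|bN0] := eqVneq b 0; first by subst b; nra.
have : b * (2 * a - v) = 0 by lra.
by move/eqP; rewrite mulf_eq0 (negPf bN0) /= => /eqP; nra.
Qed.

(** The leading coefficient of [zeta8] is q^3, and 64 = 4^3 clears the denominators of the three
    monic quadratics. *)
Lemma zeta8_factor (A : comNzRingType) (s r z : A) :
  s ^+ 2 = 2 -> r ^+ 2 = 10 ->
  64 * zeta8 A s z = (4 + 2 * s) ^+ 3 * (4 * z ^+ 2 - (2 - s))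
    * (4 * z ^+ 2 - (s + r) * z + (2 - s)) * (4 * z ^+ 2 - (s - r) * z + (2 - s)).
Proof. by move=> s2 r2; rewrite /zeta8; ring: s2 r2. Qed.

Lemma rmorph_zeta8 (K A : comNzRingType) (f : {rmorphism K -> A}) (t z : K) :
  f (zeta8 K t z) = zeta8 A (f t) (f z).
Proof. by rewrite /zeta8; ring. Qed.

Theorem theorem5p5 (R : realType) :
  exists Pplus Pminus : {poly R[i]},
    [/\ unique (is_zeta_polynomial 8 2 (q8 (Num.sqrt 2)) (phi8 (Num.sqrt 2)))
          Pplus,
        unique (is_zeta_polynomial 8 2 (q8 (- Num.sqrt 2)) (phi8 (- Num.sqrt 2)))
          Pminus,
        exists2 alpha : R[i], root Pplus alpha &
          `|alpha| <> (1 / Num.sqrt (4 + 2 * Num.sqrt 2))%:C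
      & forall alpha : R[i], root Pminus alpha ->
          `|alpha| = (1 / Num.sqrt (4 - 2 * Num.sqrt 2))%:C].
Proof.
set s := Num.sqrt 2; set r : R := Num.sqrt 10.
have s2 : s ^+ 2 = 2 by rewrite sqr_sqrtr.
have r2 : r ^+ 2 = 10 by rewrite sqr_sqrtr.
have s0 : 0 <= s by exact: sqrtr_ge0.
have r0 : 0 <= r by exact: sqrtr_ge0.
have [s_lo s_hi] : 7 / 5 < s /\ s < 3 / 2 by split; nra.
have [r_lo r_hi] : 3 < r /\ r < 7 / 2 by split; nra.
have toC (a : R) (k : nat) : a ^+ 2 = k%:R -> a%:C ^+ 2 = k%:R.
  by rewrite -rmorphXn /= => ->; rewrite rmorph_nat.
have sN2 : (- s) ^+ 2 = 2 by rewrite sqrrN.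
have linC (a b : R) : (a + b)%:C = a%:C + b%:C by rewrite rmorphD.
exists (zeta8 {poly R[i]} s%:C%:P 'X), (zeta8 {poly R[i]} (- s)%:C%:P 'X).
have zetaP (t : R) : t ^+ 2 = 2 -> 0 < q8 t -> q8 t != 1 ->
    unique (is_zeta_polynomial 8 2 (q8 t) (phi8 t)) (zeta8 {poly R[i]} t%:C%:P 'X).
  move=> t2 q0 q1; have H := zeta8_polynomial R t t2 q0 q1.
  by split=> // P'; exact: zeta_polynomial_unique.
split.
- by apply: zetaP => //; rewrite /q8; [lra | rewrite gt_eqF //; lra].
- by apply: zetaP => //; rewrite /q8; [lra | rewrite gt_eqF //; lra].
(* Here w = 1/q, as (2 - s)(4 + 2s) = 4; the discriminant is positive because v > 1 > 4w. *)
- pose v := (s + r) / 4; pose w := (2 - s) / 4.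
  have v1 : 1 < v by rewrite /v; lra.
  have disc : 0 <= v ^+ 2 - 4 * w by rewrite /w; nra.
  pose alpha := (v + Num.sqrt (v ^+ 2 - 4 * w)) / 2.
  have alpha_root : 4 * alpha ^+ 2 - (s + r) * alpha + (2 - s) = 0.
    have e := sqr_sqrtr disc.
    have d : (2 * alpha - v) ^+ 2 = v ^+ 2 - 4 * w.
      by rewrite -e /alpha; congr (_ ^+ 2); field.
    by move: d; rewrite /w /v; nra.
  have alpha_big : 1 / 2 < alpha.
    by have := sqrtr_ge0 (v ^+ 2 - 4 * w); rewrite /alpha; lra.
  exists alpha%:C.
    rewrite /root horner_zeta8.
    have f := zeta8_factor _ _ _ alpha s2 r2.
    have : zeta8 R s alpha = 0 by move: f; rewrite alpha_root; lra.
    by rewrite -(rmorph_zeta8 R R[i] (real_complex R)) => ->; rewrite rmorph0.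
  rewrite ger0_norm; last by rewrite lecR; lra.
  move=> /(congr1 (@complex.Re R)) /= e.
  have q0 : 0 < 4 + 2 * s by lra.
  (* This contradicts alpha > 1/2 and q > 4. *)
  have : alpha ^+ 2 * (4 + 2 * s) = 1.
    by rewrite e expr_div_n expr1n sqr_sqrtr ?ltW // divfK ?gt_eqF.
  nra.
move=> alpha; rewrite /root horner_zeta8 => /eqP a0.
(* Again w = 1/q, now with q = 4 - 2s. *)
pose w := (2 + s) / 4.
have -> : 1 / Num.sqrt (4 - 2 * s) = Num.sqrt w.
  rewrite div1r -sqrtrV; last lra.
  by congr Num.sqrt; apply: mulr1_eq; rewrite /w; nra.
have w0 : 0 <= w by rewrite /w; lra.
have f := zeta8_factor _ _ _ alpha (toC _ 2 sN2) (toC _ 10 r2).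
have monic (a b : R) : 4 * alpha ^+ 2 - a%:C * alpha + b%:C = 0 ->
    alpha ^+ 2 - (a / 4)%:C * alpha + (b / 4)%:C = 0.
  move=> e; have i4 : (4^-1)%:C = 4^-1 :> R[i] by rewrite fmorphV rmorph_nat.
  by rewrite !rmorphM /= i4 -[RHS](mulr0 4^-1) -e; field.
have wC : 2 - (- s)%:C = (2 + s)%:C.
  by rewrite -[s in RHS]opprK linC [(- - s)%:C]rmorphN rmorph_nat.
move/eqP: f; rewrite a0 mulr0 eq_sym wC -linC -[_%:C - _%:C]rmorphB /=.
rewrite mulf_eq0 mulf_eq0 mulf_eq0 -!orbA => /or4P[].
- rewrite expf_eq0 /= => /eqP q0.
  have : (4 + 2 * - s)%:C != 0 :> R[i] by rewrite fmorph_eq0 gt_eqF //; lra.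
  by rewrite rmorphD rmorphM /= !rmorph_nat q0 eqxx.
- move/eqP=> e; apply: norm_sqrt_root => //.
  have := monic 0 (- (2 + s)); rewrite mul0r subr0 rmorphN => /(_ e).
  by rewrite mulNr rmorphN /= mul0r mul0r subr0 => /eqP; rewrite subr_eq0 => /eqP.
(* In both remaining cases |v| <= (s + r)/4 < 5/4, so v^2 < 2 < 2 + s = 4w. *)
- move/eqP/monic; apply: norm_quadratic_root; rewrite /w; nra.
- move/eqP/monic; apply: norm_quadratic_root; rewrite /w; nra.
Qed.
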